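(* Let $S$ be a finite semigroup. Then $s,t\in S$ are linear conjugates (over $\mathbb C$) if and only if both of the following hold: (1) $s^k$ and $t^k$ are $\mathscr J$-equivalent in $S$ for all $k\geq 1$ (or, equivalently, for all $1\leq k\leq |S|$); (2) $s$ and $t$ are generalized conjugates.
   Context: Let $S$ be a finite semigroup. Linear conjugates: $s,t\in S$ are linear conjugates if, for every $n$ and every linear representation $\rho\colon S\to M_n(\mathbb C)$ (semigroup homomorphism into the multiplicative semigroup of $n\times n$ complex matrices), there is $A\in GL_n(\mathbb C)$ with $A\rho(s)A^{-1}=\rho(t)$. $\mathscr J$-equivalence: $s,t\in S$ are $\mathscr J$-equivalent if they generate the same principal two-sided ideal, i.e. $S^1sS^1=S^1tS^1$, where $S^1$ is the result of adjoining an identity to $S$. For $s\in S$, $s^{\omega}$ denotes the unique idempotent among the positive powers of $s$, and $s^{\omega+1}=s\,s^{\omega}$. Generalized conjugates: $s,t\in S$ are generalized conjugates if there exist $x,x'\in S$ such that $xx'x=x$, $x'xx'=x'$, $x'x=s^{\omega}$, $xx'=t^{\omega}$ and $xs^{\omega+1}x'=t^{\omega+1}$. *)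

(* Defs.v *)
From HB Require Import structures.
From mathcomp Require Import all_boot all_order all_algebra.
From mathcomp Require Import reals.
From mathcomp Require Import complex.

Set Implicit Arguments.
Unset Strict Implicit.
Unset Printing Implicit Defensive.

Import Algebra.

#[short(type="finSemigroupType")]
HB.structure Definition FinSemigroup := {S of Semigroup S & Finite S}.

(* [with1 S] is S^1; [None] is the adjoined identity.  An identity is adjoined
   even when S already has one, which does not change the ideals S^1 s S^1. *)
Definition with1 (S : Type) : Type := option S.

Section With1.
Variable S : finSemigroupType.

HB.instance Definition _ := Finite.on (with1 S).

Definition with1_mul (u v : with1 S) : with1 S :=
  match u, v with
  | None, _ => v
  | _, None => u
  | Some x, Some y => Some (x * y)%g
  end.

Lemma with1_mulA : associative with1_mul.
Proof. by case=> [x|] [y|] [z|] //=; rewrite mulgA. Qed.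

Lemma with1_mul1 : left_id None with1_mul. Proof. by case. Qed.

Lemma with1_mulr1 : right_id None with1_mul. Proof. by case. Qed.

HB.instance Definition _ := isSemigroup.Build (with1 S) with1_mulA.
HB.instance Definition _ :=
  Magma_isUMagma.Build (with1 S) with1_mul1 with1_mulr1.

End With1.

Section Semigroup.
Variable S : finSemigroupType.
Implicit Types s t x : S.

(* S^1 s S^1, as a subset of S^1; it never contains the adjoined identity. *)
Definition principal_ideal s : {set with1 S} :=
  [set (u * (Some s : with1 S) * v)%g | u in [set: with1 S],
                                        v in [set: with1 S]].

Definition J_equivalent s t : Prop := principal_ideal s = principal_ideal t.

(* s^k for k >= 1; a semigroup has no zeroth power, and [sgexp s 0] is the
   junk value s. *)
Definition sgexp s (k : nat) : S := iterop k *%g s s.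

Lemma sgexpS s k : sgexp s k.+2 = (s * sgexp s k.+1)%g.
Proof. by []. Qed.

Lemma sgexpD s i j :
  (0 < i)%N -> (0 < j)%N -> sgexp s (i + j) = (sgexp s i * sgexp s j)%g.
Proof.
case: i j => [//|i] [//|j] _ _; elim: i => [|i IH]; first by [].
by rewrite addSn addSn sgexpS -addSn IH sgexpS mulgA.
Qed.

Definition idempotent x : bool := (x * x == x)%g.

Lemma exists_idempotent_power s : exists k, idempotent (sgexp s k.+1).
Proof.
have [i [p [p0 per]]] : exists i p, [/\ (0 < p)%N
    & sgexp s (i.+1 + p) = sgexp s i.+1].
  pose f (k : 'I_(#|S|.+1)) := sgexp s k.+1.
  have /injectivePn[a [b ab fab]] : ~~ injectiveb f.
    by apply/negP => /injectiveP /leq_card; rewrite card_ord ltnn.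
  wlog ltab : a b ab fab / (a < b)%N.
    move=> W; case: (ltngtP a b) => [lt|lt|eq]; first exact: (W a b).
      by apply: (W b a) => //; rewrite eq_sym.
    by case/eqP: ab; apply: val_inj.
  exists a, (b - a)%N; split; first by rewrite subn_gt0.
  by rewrite addSn subnKC ?(ltnW ltab) //; symmetry; exact: fab.
have perd d : sgexp s (i.+1 + d + p) = sgexp s (i.+1 + d).
  case: d => [|d]; first by rewrite addn0.
  by rewrite addnAC sgexpD ?per -?sgexpD // addn_gt0.
have perm d q : sgexp s (i.+1 + d + q * p) = sgexp s (i.+1 + d).
  elim: q => [|q IH]; first by rewrite mul0n addn0.
  by rewrite mulSn addnCA [(p + _)%N]addnC -[(i.+1 + d + _)%N]addnA perd addnA.
exists (i.+1 * p).-1; rewrite /idempotent prednK ?muln_gt0 ?p0 //.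
rewrite -sgexpD ?muln_gt0 ?p0 //; apply/eqP.
have le : (i.+1 <= i.+1 * p)%N by rewrite leq_pmulr.
by rewrite -{1 3}(subnKC le) perm.
Qed.

Definition omega s : S := sgexp s (ex_minn (exists_idempotent_power s)).+1.

Lemma omega_idempotent s : idempotent (omega s).
Proof. by rewrite /omega; case: ex_minnP. Qed.

Lemma omega_power s : exists2 k, (0 < k)%N & omega s = sgexp s k.
Proof. by eexists; last reflexivity. Qed.

Lemma idempotent_power_omega s k :
  (0 < k)%N -> idempotent (sgexp s k) -> sgexp s k = omega s.
Proof.
have idX j m : (0 < j)%N -> idempotent (sgexp s j) ->
    sgexp s (m.+1 * j) = sgexp s j.
  move=> j0 /eqP idj; elim: m => [|m IH]; first by rewrite mul1n.
  by rewrite mulSn sgexpD ?muln_gt0 // IH idj.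
move=> k0 idk; have [l l0 e] := omega_power s; have := omega_idempotent s.
rewrite e => idl; rewrite -(idX k l.-1) // -(idX l k.-1) //.
by rewrite !prednK // mulnC.
Qed.

(* s^(omega+1). *)
Definition omega1 s : S := (s * omega s)%g.

Definition generalized_conjugates s t : Prop :=
  exists x x' : S,
    [/\ (x * x' * x = x)%g, (x' * x * x' = x')%g,
        (x' * x = omega s)%g, (x * x' = omega t)%g
      & (x * omega1 s * x' = omega1 t)%g].

Local Open Scope ring_scope.
Local Open Scope complex_scope.

(* The complex numbers are R[i] over a complete ordered field R. *)
Definition linear_conjugates (R : realType) s t : Prop :=
  forall (n : nat) (rho : S -> 'M[R[i]]_n),
    {morph rho : x y / (x * y)%g >-> x *m y} ->
    exists2 A : 'M[R[i]]_n, A \in unitmx & A *m rho s *m invmx A = rho t.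

End Semigroup.

(* Main.v *)
Require Import Defs.
From mathcomp Require Import all_boot all_order all_algebra reals.
From mathcomp Require Import separable cyclotomic complex.

Set Implicit Arguments.
Unset Strict Implicit.
Unset Printing Implicit Defensive.

Import GRing.Theory Num.Theory.

(** A complex matrix is determined up to similarity by an invertible part (the
    restriction to the stable range of its powers) and a nilpotent part, and
    the latter only depends on the ranks of the powers.  Generalized
    conjugacy controls the first part and J-equivalence of powers the second,
    in every representation at once.

    Sufficiency.  Let A and B be the matrices of s and t in a representation.
    J-equivalence of the powers of s and t gives A^k and B^k equal ranks.  A
    generalized conjugacy (x, x') satisfies s x' = x' t and x' x = s^omega, so
    it gives U and V with A U = U B and U V = A^l for some l.  These data force
    A and B to be similar ([shift_equivalent_similar]), over any field and
    without normal forms: factor A = C R and B = D T through their ranks, apply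
    induction to the smaller matrices R C and T D, and lift the similarity back
    by [invertible_completion].

    Necessity of J-equivalence.  S acts on S^1 by left multiplication; killing
    the ideal S^1 s S^1 gives a representation vanishing at s, hence at t, and
    the image of 1 under t shows that t lies in S^1 s S^1
    ([linear_conjugates_mem_ideal]).  By symmetry, and because the powers of
    linear conjugates are linear conjugates, all powers are J-equivalent.

    Necessity of generalized conjugacy.  If a matrix P with P^(d+1) = P
    commutes with a representation rho, then P is a combination of projections whose ranges are
    subrepresentations, so that tr (rho(s) P) = tr (rho(t) P)
    ([trace_commutant]); this step uses the d-th roots of unity in the field.
    Let e = s^omega and let g be the inverse of s e in the maximal subgroup at
    e.  For left multiplication on the elements y with e in S y e, and right
    multiplication by g as P, the trace of rho(x) P is the number of y with
    x y g = y.  The solution y = e for x = s forces one for x = t, that is, an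
    intertwiner t y = y s such that y is L-equivalent to e
    ([linear_conjugates_intertwiner]).  An intertwiner in each direction makes
    y invertible between the two maximal subgroups, by finiteness
    ([intertwiners_generalized_conjugates]).  In the group case this is the
    theorem that characters separate conjugacy classes, obtained by counting
    instead of orthogonality relations. *)

(** * Similarity of matrices from shift equivalence and ranks *)

Section Similarity.
Local Open Scope ring_scope.
Variable F : fieldType.

(** The rows of [K] span a complement of the row space of [R] inside its sum
    with [kermx C].  The height [k] is a variable so that the bases obtained
    for two pairs (R, C) with equal ranks have the same type. *)
Lemma row_basis_through_kernel (p q n k : nat) (R : 'M[F]_(p, n))
    (C : 'M[F]_(n, q)) :
  row_free R -> k = \rank (kermx C :\: R)%MS ->
  exists K : 'M[F]_(k, n),
    [/\ K *m C = 0, row_free (col_mx R K) & (kermx C <= col_mx R K)%MS].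
Proof.
move=> freeR ->; exists (row_base (kermx C :\: R)%MS).
have capKR0 : (R :&: (kermx C :\: R))%MS = 0.
  by apply/eqP; rewrite -submx0 capmxC capmx_diff.
split.
- by apply/sub_kermxP; rewrite eq_row_base diffmxSl.
- rewrite /row_free -addsmxE (adds_eqmx (eqmx_refl R) (eq_row_base _)).
  by rewrite mxrank_disjoint_sum // (eqP freeR).
- rewrite -addsmxE (adds_eqmx (eqmx_refl R) (eq_row_base _)).
  rewrite -(addsmx_diff_cap_eq (kermx C) R) addsmx_sub addsmxSr /=.
  exact: submx_trans (capmxSr _ _) (addsmxSl _ _).
Qed.

(** A Witt-type extension property.  The matrix [Q] is prescribed on the row
    space of [R] by [R *m Q = T] and modulo the kernel of [D] by [Q *m D = C];
    [R *m C = T *m D] is the compatibility of the two prescriptions.  It also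
    makes the row space of [R] meet [kermx C] in the same dimension as that of
    [T] meets [kermx D], so the map sending the rows of [R] to those of [T]
    extends to an isomorphism carrying [kermx C] onto [kermx D]; any further
    extension with [Q *m D = C] is then injective. *)
Lemma invertible_completion (p q n : nat) (R T : 'M[F]_(p, n))
    (C D : 'M[F]_(n, q)) :
  row_free R -> row_free T -> row_full C -> row_full D ->
  R *m C = T *m D ->
  exists2 Q : 'M[F]_n, Q \in unitmx & R *m Q = T /\ Q *m D = C.
Proof.
move=> freeR freeT fullC fullD RC.
have rank_ker (X : 'M[F]_(n, q)) : row_full X -> \rank (kermx X) = (n - q)%N.
  by move=> fullX; rewrite mxrank_ker (eqP fullX).
have rank_diff : \rank (kermx C :\: R)%MS = \rank (kermx D :\: T)%MS.
  have capCD : \rank (kermx C :&: R)%MS = \rank (kermx D :&: T)%MS.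
    apply: (@addnI (\rank (T *m D))); rewrite ![(kermx _ :&: _)%MS]capmxC.
    by rewrite mxrank_mul_ker -RC mxrank_mul_ker (eqP freeR) (eqP freeT).
  apply: (@addnI (\rank (kermx D :&: T)%MS)); rewrite -{1}capCD.
  by rewrite !mxrank_cap_compl !rank_ker.
have [K [KC0 freeX subX]] :=
  row_basis_through_kernel freeR (erefl (\rank (kermx C :\: R)%MS)).
have [K' [KD0 freeY _]] := row_basis_through_kernel freeT rank_diff.
set X := col_mx R K in freeX subX; set Y := col_mx T K' in freeY.
have XC : X *m C = Y *m D by rewrite !mul_col_mx RC KC0 KD0.
(* [pinvmx X *m X] is a projection onto the row space of [X]: there [Q] sends
   [X] to [Y], and on the complement it lifts [C] through [D]. *)
pose Q := pinvmx X *m Y + (1%:M - pinvmx X *m X) *m C *m pinvmx D.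
have Xp := mulmxVp freeX; have pD := mulVpmx fullD.
have XQ : X *m Q = Y.
  have X0 : X *m (1%:M - pinvmx X *m X) = 0.
    by rewrite mulmxBr mulmx1 mulmxA Xp mul1mx subrr.
  by rewrite mulmxDr (mulmxA X) Xp mul1mx -(mulmxA _ C) (mulmxA X)
             X0 mul0mx addr0.
have QD : Q *m D = C.
  rewrite mulmxDl -(mulmxA _ _ D) -(mulmxA _ (pinvmx D)) pD mulmx1 -XC.
  by rewrite mulmxBl mul1mx -(mulmxA _ X) addrC subrK.
exists Q; last first.
  split=> //; move: XQ; rewrite mul_col_mx => /(congr1 usubmx).
  by rewrite !col_mxKu.
rewrite -row_free_unit -kermx_eq0 -submx0; apply/rV_subP => v /sub_kermxP vQ0.
have /submxP[a va] : (v <= X)%MS.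
  by apply: submx_trans subX; apply/sub_kermxP; rewrite -QD mulmxA vQ0 mul0mx.
move: vQ0; rewrite va -mulmxA XQ => /(congr1 (mulmx^~ (pinvmx Y))).
by rewrite /= mulmxKp // mul0mx => ->; rewrite mul0mx sub0mx.
Qed.

Lemma rank_factorization (r m n : nat) (A : 'M[F]_(m, n)) :
  \rank A = r ->
  exists C : 'M[F]_(m, r), exists R : 'M[F]_(r, n),
    [/\ row_full C, row_free R & A = C *m R].
Proof.
move=> <-; exists (col_base A), (row_base A).
by rewrite col_base_full row_base_free mulmx_base.
Qed.

(** The ring laws of square matrices phrased with [*m], so that powers combine
    with rectangular factors. *)
Lemma exprmxS (n k : nat) (A : 'M[F]_n) : A ^+ k.+1 = A *m A ^+ k.
Proof. exact: exprS. Qed.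

Lemma exprmxSr (n k : nat) (A : 'M[F]_n) : A ^+ k.+1 = A ^+ k *m A.
Proof. exact: exprSr. Qed.

Lemma exprmx_factor (n r k : nat) (C : 'M[F]_(n, r)) (R : 'M[F]_(r, n)) :
  (C *m R) ^+ k.+1 = C *m (R *m C) ^+ k *m R.
Proof.
elim: k => [|k IH]; first by rewrite expr1 expr0 mulmx1.
by rewrite exprmxS IH [in RHS]exprmxS !mulmxA.
Qed.

Lemma rank_exp_factor (n r k : nat) (C : 'M[F]_(n, r)) (R : 'M[F]_(r, n)) :
  row_full C -> row_free R ->
  \rank ((R *m C) ^+ k) = \rank ((C *m R) ^+ k.+1).
Proof.
move=> fullC freeR; rewrite exprmx_factor mxrankMfree //.
rewrite -[RHS]mxrank_tr trmx_mul.
by rewrite mxrankMfree ?mxrank_tr // /row_free mxrank_tr.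
Qed.

(** The intertwiner [U] need not be invertible; [U *m V = A ^+ l] says that it
    is injective on the stable range of [A].  Passing from A = C R to R C
    replaces [A] by its restriction to its own range, which strips one box
    from every nilpotent Jordan block; equality of the ranks of the powers is
    what makes this step reversible. *)
Lemma shift_equivalent_similar (n l : nat) (A B U V : 'M[F]_n) :
  A *m U = U *m B -> U *m V = A ^+ l ->
  (forall k, \rank (A ^+ k) = \rank (B ^+ k)) ->
  exists2 Q : 'M[F]_n, Q \in unitmx & A *m Q = Q *m B.
Proof.
elim/ltn_ind: n l A B U V => n IH l A B U V AU UV rAB.
have rAB1 : \rank B = \rank A by rewrite -[A]expr1 -[B]expr1 rAB.
have [ltAn|] := ltnP (\rank A) n; last first.
  move=> fullA; have unitA : A \in unitmx.
    by rewrite -row_full_unit /row_full eqn_leq rank_leq_col.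
  have : U *m V \in unitmx.
    rewrite UV; elim: (l) => [|m IHm]; first by rewrite expr0 unitmx1.
    by rewrite exprmxS unitmx_mul unitA.
  by rewrite unitmx_mul => /andP[unitU _]; exists U.
have [C [R [fullC freeR defA]]] := rank_factorization (erefl (\rank A)).
have [D [T [fullD freeT defB]]] := rank_factorization rAB1.
move: (\rank A) ltAn C R fullC freeR defA D T fullD freeT defB {rAB1}.
move=> r ltrn C R fullC freeR defA D T fullD freeT defB.
have [||k|P unitP RCP] :=
  IH r ltrn l.+2 (R *m C) (T *m D) (R *m U *m D) (T *m V *m C).
- transitivity (R *m (A *m U) *m D); first by rewrite defA !mulmxA.
  by rewrite AU defB !mulmxA.
- have AUV : A ^+ l.+1 = U *m (D *m T) *m V.
    by rewrite exprmxS -UV -defB -AU -mulmxA.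
  transitivity (R *m A ^+ l.+1 *m C); first by rewrite AUV !mulmxA.
  by rewrite defA exprmx_factor exprmxS exprmxSr !mulmxA.
- rewrite (rank_exp_factor k fullC freeR) (rank_exp_factor k fullD freeT).
  by rewrite -defA -defB.
(* The new [Q] has to satisfy [R *m Q = P *m T] and [Q *m D = C *m P], which
   says that it extends [P] from the ranges of [A] and [B]. *)
have RC : R *m C = (P *m T) *m (D *m invmx P).
  by rewrite !mulmxA -(mulmxA P) -RCP mulmxK.
have [||Q unitQ [RQ QD]] := invertible_completion freeR _ fullC _ RC.
- by rewrite /row_free mxrankMfree // -/(row_free P) row_free_unit.
- by rewrite /row_full mxrankMfree // row_free_unit unitmx_inv.
exists Q => //; have {}QD : Q *m D = C *m P by rewrite -QD !mulmxA mulmxKV.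
by rewrite defA defB -mulmxA RQ !mulmxA QD.
Qed.

End Similarity.

(** * Matrices of partial maps and their traces *)

Section PartialMaps.
Local Open Scope ring_scope.
Variables (F : numFieldType) (T : finType) (M : pred T).
Implicit Types f g : T -> T.

(** The linear map induced by [f] on the free module over [T], followed by the
    projection that kills the points outside [M]. *)
Definition partial_map_mx f : 'M[F]_#|T| :=
  \matrix_(i, j) ((f (enum_val j) == enum_val i) && M (enum_val i))%:R.

Lemma eq_partial_map_mx f g : f =1 g -> partial_map_mx f = partial_map_mx g.
Proof. by move=> fg; apply/matrixP=> i j; rewrite !mxE fg. Qed.

(** By hypothesis [f] sends the values of [g] lying outside [M] to points
    outside [M], so that killing them before [f] changes nothing. *)
Lemma partial_map_mx_comp f g : (forall a, M (f (g a)) -> M (g a)) ->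
  partial_map_mx f *m partial_map_mx g = partial_map_mx (f \o g).
Proof.
move=> Mfg; apply/matrixP=> i j; rewrite !mxE.
rewrite (bigD1 (enum_rank (g (enum_val j)))) //= !mxE enum_rankK eqxx /=.
rewrite big1 ?addr0 => [|k neq]; last first.
  rewrite !mxE [g _ == _](_ : _ = false) ?mulr0 //.
  by apply: contraNF neq => /eqP ->; rewrite enum_valK.
have [<-|] := eqVneq (f (g (enum_val j))) (enum_val i); last by rewrite mul0r.
rewrite -natrM mulnb andTb; congr (_%:R); congr nat_of_bool.
by apply/andP/idP => [[]|Mc] //; split=> //; apply: Mfg.
Qed.

Lemma trace_partial_map_mx f :
  \tr (partial_map_mx f) = #|[set a | M a & f a == a]|%:R.
Proof.
rewrite /mxtrace (reindex _ (onW_bij _ (@enum_rank_bij T))) /=.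
rewrite -[in RHS]sum1_card natr_sum [RHS]big_mkcond.
by apply: eq_bigr => a _; rewrite mxE enum_rankK inE andbC; case: ifP.
Qed.

End PartialMaps.

(** * Traces of linear conjugates against commuting matrices *)

Lemma unity_roots (C : numClosedFieldType) (d : nat) : (0 < d)%N ->
  exists rs : seq C, [/\ size rs = d, uniq rs
    & forall w, w \in rs -> (w ^+ d = 1)%R].
Proof.
move=> d_gt0; have [rs def] := closed_field_poly_normal ('X^d - 1 : {poly C})%R.
move: def; rewrite (monicP (monicXnsubC 1%R d_gt0)) scale1r => def.
exists rs; split.
- have := congr1 (fun p : {poly C} => size p) def.
  by rewrite size_prod_XsubC size_XnsubC // => -[].
- by rewrite -separable_prod_XsubC -def separable_Xn_sub_1 // pnatr_eq0 -lt0n.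
- move=> w; rewrite -root_prod_XsubC -def /root !hornerE subr_eq0.
  by move/eqP.
Qed.

Section CommutingTrace.
Local Open Scope ring_scope.
Local Open Scope complex_scope.
Variables (R : realType) (S : finSemigroupType) (s t : S).
Hypothesis lin_st : linear_conjugates R s t.
Variables (n : nat) (rho : S -> 'M[R[i]]_n).
Hypothesis rhoM : {morph rho : x y / (x * y)%g >-> x *m y}.

(** The range of [E] is a subrepresentation, realized in coordinates by
    compressing with a rank factorization of [E]; the trace of [rho x *m E] is
    its character at x. *)
Lemma trace_idempotent_commutant (E : 'M[R[i]]_n) :
  E *m E = E -> (forall x, rho x *m E = E *m rho x) ->
  \tr (rho s *m E) = \tr (rho t *m E).
Proof.
move=> idE commE.
have [C [D [_ freeD defE]]] := rank_factorization (erefl (\rank E)).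
have CE : E *m C = C.
  have := idE; rewrite {2 3}defE mulmxA => /(congr1 (mulmx^~ (pinvmx D))) /=.
  by rewrite !mulmxKp.
pose sub x := D *m rho x *m C.
have subM : {morph sub : x y / (x * y)%g >-> x *m y}.
  move=> x y; rewrite /sub rhoM -!mulmxA (mulmxA C) -defE.
  by rewrite (mulmxA E) -commE -(mulmxA _ E) CE.
have [A unitA] := lin_st subM => /(congr1 mxtrace).
rewrite mxtrace_mulC mulmxA mulVmx // mul1mx /sub.
by rewrite -2!(mulmxA D) 2![\tr (D *m _)]mxtrace_mulC -2!mulmxA -defE.
Qed.

(** For each root of unity [w] the mean of the powers of [w *: P] is the
    projection onto the eigenspace of [P] for the eigenvalue 1 / w.  Comparing
    traces on these projections says that a polynomial of size at most [d],
    whose coefficients are the differences of the traces against the powers of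
    [P], vanishes at all [d] roots of unity. *)
Lemma trace_commutant (d : nat) (P : 'M[R[i]]_n) :
  (0 < d)%N -> P ^+ d.+1 = P -> (forall x, rho x *m P = P *m rho x) ->
  \tr (rho s *m P) = \tr (rho t *m P).
Proof.
move=> d_gt0 Pd commP.
have commX x k : rho x *m P ^+ k = P ^+ k *m rho x.
  elim: k => [|k IH]; first by rewrite expr0 mulmx1 mul1mx.
  by rewrite exprmxS mulmxA commP -mulmxA IH mulmxA.
pose tau X := \tr (rho s *m X) - \tr (rho t *m X).
pose p := \poly_(i < d) tau (P ^+ i.+1).
suff : p`_0 = 0.
  by rewrite coef_poly d_gt0 expr1 => /eqP; rewrite subr_eq0 => /eqP.
suff -> : p = 0 by rewrite coef0.
have [rs [size_rs uniq_rs rsd]] :=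
  @unity_roots (R[i] : numClosedFieldType) d d_gt0.
apply/eqP; apply: contraTT (size_poly d (fun i => tau (P ^+ i.+1))) => p_neq0.
rewrite -ltnNge -{1}size_rs; apply: max_poly_roots => //.
apply/allP=> w /rsd wd.
pose N := w *: P.
have NX k : N ^+ k = w ^+ k *: P ^+ k.
  elim: k => [|k IH]; first by rewrite !expr0 scale1r.
  by rewrite !exprmxS IH -scalemxAl -scalemxAr scalerA -exprS.
have Nd : N ^+ d.+1 = N by rewrite NX Pd exprS wd mulr1.
pose sumN := \sum_(i < d) N ^+ i.+1.
have N_sum : N *m sumN = sumN.
  rewrite /sumN mulmx_sumr -(prednK d_gt0) big_ord_recr big_ord_recl /= addrC.
  by rewrite -exprmxS prednK // Nd expr1.
have NX_sum k : N ^+ k *m sumN = sumN.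
  elim: k => [|k IH]; first by rewrite expr0 mul1mx.
  by rewrite exprmxSr -mulmxA N_sum.
have d_neq0 : d%:R != 0 :> R[i] by rewrite pnatr_eq0 -lt0n.
pose E := d%:R^-1 *: sumN.
have idE : E *m E = E.
  rewrite -scalemxAr -scalemxAl {1}/sumN mulmx_suml.
  under eq_bigr do rewrite NX_sum.
  rewrite sumr_const card_ord -(scaler_nat d sumN) (scalerA _ d%:R).
  by rewrite mulVf // scale1r.
have commE x : rho x *m E = E *m rho x.
  rewrite -scalemxAr -scalemxAl mulmx_sumr mulmx_suml; congr (_ *: _).
  by apply: eq_bigr => i _; rewrite NX -scalemxAr -scalemxAl commX.
have trE x : \tr (rho x *m E) =
    d%:R^-1 * \sum_(i < d) w ^+ i.+1 * \tr (rho x *m P ^+ i.+1).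
  rewrite -scalemxAr mxtraceZ mulmx_sumr raddf_sum; congr (_ * _).
  by apply: eq_bigr => i _; rewrite /= NX -scalemxAr mxtraceZ.
have /eqP := trace_idempotent_commutant idE commE.
rewrite !trE -subr_eq0 -mulrBr mulf_eq0 invr_eq0 (negPf d_neq0) /= -sumrB.
under eq_bigr do rewrite -mulrBr exprS -mulrA.
have w_neq0 : w != 0.
  apply/eqP=> w0; move/eqP: wd.
  by rewrite w0 expr0n eqn0Ngt d_gt0 eq_sym oner_eq0.
rewrite -mulr_sumr mulf_eq0 (negPf w_neq0) /= /root horner_poly.
by under eq_bigr do rewrite mulrC.
Qed.

End CommutingTrace.

(** * Powers in a finite semigroup *)

Section Powers.
Local Open Scope group_scope.
Variable S : finSemigroupType.
Implicit Types s t x y z e f u v w : S.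

Lemma sgexpM s i j : (0 < i)%N -> (0 < j)%N ->
  sgexp s (i * j) = sgexp (sgexp s i) j.
Proof.
move=> i0; case: j => // j _; elim: j => [|j IH]; first by rewrite muln1.
by rewrite mulnS sgexpD // ?muln_gt0 ?i0 // IH sgexpS.
Qed.

Lemma sgexp_comm s i j : (0 < i)%N -> (0 < j)%N ->
  sgexp s i * sgexp s j = sgexp s j * sgexp s i.
Proof. by move=> i0 j0; rewrite -!sgexpD // addnC. Qed.

Lemma sgexp_idempotent e j : Defs.idempotent e -> (0 < j)%N -> sgexp e j = e.
Proof.
move=> /eqP ee; case: j => // j _; elim: j => // j IH.
by rewrite sgexpS IH.
Qed.

(** A common exponent lets an intertwiner of s and t be compared with both
    idempotents at once. *)
Lemma omega_exponent2 s t :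
  exists2 k, (0 < k)%N & omega s = sgexp s k /\ omega t = sgexp t k.
Proof.
have [i i0 si] := omega_power s; have [j j0 tj] := omega_power t.
have [ids idt] := (omega_idempotent s, omega_idempotent t).
exists (i * j)%N; first by rewrite muln_gt0 i0.
split; first by rewrite sgexpM // -si sgexp_idempotent.
by rewrite mulnC sgexpM // -tj sgexp_idempotent.
Qed.

Lemma omega_mul_sgexp s k i : (0 < k <= i)%N -> omega s = sgexp s k ->
  omega s * sgexp s i = sgexp s i.
Proof.
case/andP=> k0 le_ki ek; have /eqP ee := omega_idempotent s.
have [<-|] := eqVneq k i; first by rewrite -ek.
rewrite eq_sym => neq; have lt : (k < i)%N by rewrite ltn_neqAle eq_sym neq.
by rewrite -(subnKC le_ki) sgexpD ?subn_gt0 // -ek mulgA ee.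
Qed.

Lemma mul_omegaC s : s * omega s = omega s * s.
Proof. by have [k k0 ->] := omega_power s; apply: (@sgexp_comm s 1). Qed.

(** [g] is the inverse of [omega1 s] in the maximal subgroup at [omega s];
    with omega s = s^k it is s^(2k-1), the exponent being large enough for
    the factor [omega s] to be absorbed. *)
Lemma omega_group_inverse s : exists g d,
  [/\ (0 < d)%N, s * g = omega s, g * s = omega s, g * omega s = g
    & sgexp g d.+1 = g].
Proof.
have [k k0 ek] := omega_power s; have /eqP ee := omega_idempotent s.
have j0 : (0 < k + k.-1)%N by rewrite addn_gt0 k0.
have kk : (k + k = (k + k.-1) + 1)%N by rewrite addn1 -addnS prednK.
have sg : sgexp s (k + k.-1) * s = omega s.
  by rewrite -[s in _ * s]/(sgexp s 1) -sgexpD // -kk sgexpD // -ek.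
have le : (0 < k <= k + k.-1)%N by rewrite k0 leq_addr.
have ge := omega_mul_sgexp le ek.
exists (sgexp s (k + k.-1)), k; split=> //.
- by rewrite -[s in s * _]/(sgexp s 1) sgexp_comm // sg.
- by rewrite ek sgexp_comm // -ek.
- rewrite -addn1 sgexpD // -sgexpM // mulnC sgexpM // -ek.
  by rewrite sgexp_idempotent ?omega_idempotent.
Qed.

Lemma intertwine_sgexp s t y j : (0 < j)%N -> t * y = y * s ->
  sgexp t j * y = y * sgexp s j.
Proof.
move=> j0 ty; case: j j0 => // j _; elim: j => // j IH.
by rewrite !sgexpS -mulgA IH mulgA ty mulgA.
Qed.

Lemma intertwine_omega s t y : t * y = y * s ->
  omega t * y = y * omega s.
Proof.
by have [k k0 [-> ->]] := omega_exponent2 s t; apply: intertwine_sgexp.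
Qed.

End Powers.

(** * Principal ideals and J-equivalence *)

Section Ideals.
Variable S : finSemigroupType.
Implicit Types s t x y z : S.
Local Open Scope group_scope.

Lemma principal_idealP s (a : with1 S) :
  reflect (exists u v : with1 S, a = u * Some s * v) (a \in principal_ideal s).
Proof.
apply: (iffP imset2P) => [[u v _ _ ->]|[u [v ->]]]; first by exists u, v.
by exists u v; rewrite ?inE.
Qed.

Lemma mem_principal_ideal s : Some s \in principal_ideal s.
Proof. by apply/principal_idealP; exists None, None. Qed.

Lemma principal_ideal_mulr s a (v : with1 S) :
  a \in principal_ideal s -> a * v \in principal_ideal s.
Proof.
case/principal_idealP=> x [y ->]; apply/principal_idealP.
by exists x, (y * v); rewrite !mulgA.
Qed.

Lemma principal_ideal_mull s a (u : with1 S) :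
  a \in principal_ideal s -> u * a \in principal_ideal s.
Proof.
case/principal_idealP=> x [y ->]; apply/principal_idealP.
by exists (u * x), y; rewrite !mulgA.
Qed.

Lemma principal_ideal_sub s t :
  (principal_ideal s \subset principal_ideal t)
    = (Some s \in principal_ideal t).
Proof.
apply/subsetP/idP => [sub|/principal_idealP[u [v es]] a].
  exact/sub/mem_principal_ideal.
case/principal_idealP=> x [y ->].
by apply/principal_idealP; exists (x * u), (v * y); rewrite es !mulgA.
Qed.

Lemma J_equivalentP s t : J_equivalent s t <->
  Some s \in principal_ideal t /\ Some t \in principal_ideal s.
Proof.
rewrite -!principal_ideal_sub; split=> [->|[st ts]]; first by rewrite subxx.
by apply/eqP; rewrite eqEsubset st.
Qed.

Lemma sgexp_principal_ideal s i j : (0 < i <= j)%N ->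
  Some (sgexp s j) \in principal_ideal (sgexp s i).
Proof.
case/andP=> i0 le_ij; have [->|neq] := eqVneq i j.
  exact: mem_principal_ideal.
have lt_ij : (i < j)%N by rewrite ltn_neqAle neq.
rewrite -(subnKC le_ij) sgexpD ?subn_gt0 //.
apply: (@principal_ideal_mulr _ (Some _) (Some _)).
exact: mem_principal_ideal.
Qed.

(** Among the first #|S| + 1 powers two coincide, so s^#|S| already lies in the
    periodic part of the sequence of powers, where each power divides every
    other. *)
Lemma sgexp_stable s k : (#|S| <= k)%N ->
  J_equivalent (sgexp s k) (sgexp s #|S|).
Proof.
have S_gt0 : (0 < #|S|)%N by apply/card_gt0P; exists s.
move=> le_Sk; apply/J_equivalentP.
split; first by apply: sgexp_principal_ideal; rewrite S_gt0.
have [i [p [p0 le_iS per]]] : exists i p, [/\ (0 < p)%N, (i < #|S|)%N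
    & sgexp s (i.+1 + p) = sgexp s i.+1].
  pose f (k : 'I_(#|S|.+1)) := sgexp s k.+1.
  have /injectivePn[a [b ab fab]] : ~~ injectiveb f.
    by apply/negP => /injectiveP /leq_card; rewrite card_ord ltnn.
  wlog ltab : a b ab fab / (a < b)%N.
    move=> W; case: (ltngtP a b) => [lt|lt|eq]; first exact: (W a b).
      by apply: (W b a) => //; rewrite eq_sym.
    by case/eqP: ab; apply: val_inj.
  exists a, (b - a)%N; split; first by rewrite subn_gt0.
    by apply: leq_trans ltab _; rewrite -ltnS ltn_ord.
  by rewrite addSn subnKC ?(ltnW ltab).
have perd d : sgexp s (i.+1 + d + p) = sgexp s (i.+1 + d).
  case: d => [|d]; first by rewrite addn0.
  by rewrite addnAC sgexpD ?per -?sgexpD // addn_gt0.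
have perS q : sgexp s (#|S| + q * p) = sgexp s #|S|.
  rewrite -(subnKC le_iS).
  elim: q => [|q IH]; first by rewrite mul0n addn0.
  by rewrite mulSnr addnA -[(_ + _ + q * p)%N]addnA perd addnA.
rewrite -(perS k); apply: sgexp_principal_ideal.
rewrite (leq_trans S_gt0 le_Sk) /=.
by apply: leq_trans (leq_addl _ _); rewrite leq_pmulr.
Qed.

Lemma J_equivalent_bounded s t :
  (forall k, (1 <= k)%N -> J_equivalent (sgexp s k) (sgexp t k)) <->
  (forall k, (1 <= k <= #|S|)%N -> J_equivalent (sgexp s k) (sgexp t k)).
Proof.
have S_gt0 : (0 < #|S|)%N by apply/card_gt0P; exists s.
split=> [H k /andP[k1 _]|H k k1]; first exact: H.
have [le_kS|/ltnW lt_Sk] := leqP k #|S|; first by apply: H; rewrite k1.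
rewrite /J_equivalent (sgexp_stable s lt_Sk) (sgexp_stable t lt_Sk).
by apply: H; rewrite S_gt0 leqnn.
Qed.

End Ideals.

(** * Consequences of linear conjugacy *)

Section LinearToSemigroup.
Variables (R : realType) (S : finSemigroupType).
Implicit Types s t x y z : S.
Local Open Scope ring_scope.
Local Open Scope complex_scope.
Local Open Scope group_scope.

Lemma linear_conjugates_sym s t :
  linear_conjugates R s t -> linear_conjugates R t s.
Proof.
move=> st n rho rhoM; have [A uA <-] := st n rho rhoM.
exists (invmx A); first by rewrite unitmx_inv.
by rewrite invmxK !mulmxA mulVmx // mul1mx mulmxKV.
Qed.

Lemma morph_sgexp n (rho : S -> 'M[R[i]]_n) s k :
  {morph rho : x y / (x * y)%g >-> x *m y} ->
  rho (sgexp s k.+1) = (rho s ^+ k.+1)%R.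
Proof.
by move=> rhoM; elim: k => // k IH; rewrite sgexpS rhoM IH -exprmxS.
Qed.

Lemma linear_conjugates_sgexp s t k : (0 < k)%N ->
  linear_conjugates R s t -> linear_conjugates R (sgexp s k) (sgexp t k).
Proof.
case: k => // k _ st n rho rhoM; have [A uA eA] := st n rho rhoM.
exists A => //; rewrite !morph_sgexp // -eA.
elim: k => [|k IH]; first by rewrite !expr1.
by rewrite exprmxS [in RHS]exprmxS -IH !mulmxA mulmxKV.
Qed.

(** The representation is left multiplication on S^1 modulo the ideal
    generated by s.  It vanishes at s, hence at t, and its entry at column 1
    and row t can only vanish if t is in the ideal. *)
Lemma linear_conjugates_mem_ideal s t :
  linear_conjugates R s t -> Some t \in principal_ideal s.
Proof.
pose M : pred (with1 S) := fun a => a \notin principal_ideal s.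
pose rho x := partial_map_mx R[i] M (fun a => (Some x : with1 S) * a).
have rhoM : {morph rho : x y / (x * y)%g >-> x *m y}.
  move=> x y; rewrite /rho partial_map_mx_comp.
    by apply: eq_partial_map_mx => a; rewrite /= mulgA.
  by move=> a; apply: contra; apply: principal_ideal_mull.
move=> st; have [A _ eA] := st _ _ rhoM; apply: contraT => t_notin.
have rho_s : rho s = 0%R.
  apply/matrixP => i j; rewrite !mxE; case: eqP => //= <-.
  by rewrite /M principal_ideal_mulr // mem_principal_ideal.
move: eA; rewrite rho_s mulmx0 mul0mx => /matrixP.
move=> /(_ (enum_rank (Some t)) (enum_rank None)); rewrite !mxE !enum_rankK.
by rewrite mulg1 eqxx /M t_notin => /eqP; rewrite eq_sym oner_eq0.
Qed.

(** The relations say that [y] intertwines s with t and is L-equivalent to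
    [omega s].  Existence is a count: the number of [y] in [M] with
    x y g = y is a trace against the commuting matrix of right multiplication
    by [g], hence the same for x = s and x = t; and y = omega s is a solution
    for x = s.  The complement of [M] is a left ideal, so it may be factored
    out of the left regular representation. *)
Lemma linear_conjugates_intertwiner s t : linear_conjugates R s t ->
  exists y z : S,
    [/\ t * y = y * s, z * y = omega s & y * omega s = y].
Proof.
move=> st; set e := omega s; have /eqP ee := omega_idempotent s.
rewrite -/e in ee.
have [g [d [d_gt0 sg gs ge gd]]] := omega_group_inverse s.
rewrite -/e in sg gs ge.
pose M : pred S := fun y => [exists z, z * y * e == e].
have MP y : reflect (exists z, z * y * e = e) (M y).
  by apply: (iffP existsP) => [[z /eqP]|[z /eqP]]; exists z.
have Ml x y : M (x * y) -> M y.
  by case/MP=> z ez; apply/MP; exists (z * x); rewrite -(mulgA z).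
have Mr y : M (y * g) -> M y.
  case/MP=> z; rewrite mulgA -(mulgA _ g) ge => zyg.
  have zye : z * y * e = e * s by rewrite -{1}gs mulgA zyg.
  by apply/MP; exists (g * z); rewrite -!mulgA (mulgA z) zye mulgA ge gs.
pose rho x := partial_map_mx R[i] M (fun a => x * a).
have rhoM : {morph rho : x y / (x * y)%g >-> x *m y}.
  move=> x y; rewrite /rho partial_map_mx_comp => [|a]; last exact: Ml.
  by apply: eq_partial_map_mx => a; rewrite /= mulgA.
pose P := partial_map_mx R[i] M (fun a => a * g).
have commP x : rho x *m P = P *m rho x.
  rewrite /rho /P !partial_map_mx_comp => [|a|a]; first last.
  - exact: Ml.
  - exact: Mr.
  by apply: eq_partial_map_mx => a; rewrite /= mulgA.
have PX k : (P ^+ k.+1)%R = partial_map_mx R[i] M (fun a => a * sgexp g k.+1).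
  elim: k => // k IH; rewrite exprmxSr IH partial_map_mx_comp.
    by apply: eq_partial_map_mx => a; apply/esym/mulgA.
  elim: k {IH} => [|k IH] a; first exact: Mr.
  rewrite -[k.+2]addn1 sgexpD // mulgA => /Mr; exact: IH.
have Pd : (P ^+ d.+1 = P)%R by rewrite PX gd.
pose fix_set x := [set a | M a & x * (a * g) == a].
have trP x : (\tr (rho x *m P) = #|fix_set x|%:R)%R.
  rewrite /rho /P partial_map_mx_comp => [|a]; last exact: Ml.
  exact: trace_partial_map_mx.
have := trace_commutant st rhoM d_gt0 Pd commP.
rewrite !trP => /eqP; rewrite eqr_nat => /eqP card_eq.
have : (0 < #|fix_set t|)%N.
  rewrite -card_eq; apply/card_gt0P; exists e; rewrite inE.
  rewrite mulgA mul_omegaC -mulgA sg ee eqxx andbT.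
  by apply/MP; exists e; rewrite !ee.
case/card_gt0P => y; rewrite inE /= => /andP[/MP[z zy] /eqP ty].
have ye : y * e = y by rewrite -ty -!mulgA ge.
exists y, z; split=> //; last by rewrite -zy -mulgA ye.
by rewrite -[y in RHS]ty -!mulgA gs -/e ye.
Qed.

End LinearToSemigroup.

(** * Generalized conjugacy *)

Section GeneralizedConjugacy.
Variable S : finSemigroupType.
Implicit Types s t x y z : S.
Local Open Scope group_scope.

(** On the finite set of the a with f a = a, left multiplication by [w] is
    injective because of [u], hence surjective, and [f] lies in this set. *)
Lemma finite_right_inverse (f u w : S) :
  f * f = f -> f * w = w -> u * w = f -> exists v, w * v = f.
Proof.
move=> ff fw uw; pose A := [set a | f * a == a].
have inj_w : {in A &, injective (fun a => w * a)}.
  move=> a b; rewrite !inE => /eqP fa /eqP fb /(congr1 (fun a => u * a)).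
  by rewrite !mulgA uw fa fb.
have imA : [set w * a | a in A] = A.
  apply/eqP; rewrite eqEcard (card_in_imset inj_w) leqnn andbT.
  by apply/subsetP => _ /imsetP[a _ ->]; rewrite inE mulgA fw.
have : f \in A by rewrite inE ff.
by rewrite -imA => /imsetP[v _ ->]; exists v.
Qed.

(** The product y y' has the left inverse z' z over [omega t], so it has a
    right inverse too; thus [y] is R-equivalent to [omega t] as well as
    L-equivalent to [omega s], which provides the inverse x'. *)
Lemma intertwiners_generalized_conjugates s t y z y' z' :
  t * y = y * s -> z * y = omega s -> y * omega s = y ->
  s * y' = y' * t -> z' * y' = omega t -> y' * omega t = y' ->
  generalized_conjugates s t.
Proof.
move=> ty zy ye sy' zy' y'f.
have fy : omega t * y = y by rewrite (intertwine_omega ty).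
have ey' : omega s * y' = y' by rewrite (intertwine_omega sy').
have /eqP ff := omega_idempotent t.
have [||v wv] := @finite_right_inverse (omega t) (z' * z) (y * y') ff.
- by rewrite mulgA fy.
- by rewrite -mulgA (mulgA z) zy ey'.
pose x' := y' * v * omega t.
have yx' : y * x' = omega t by rewrite /x' !mulgA wv ff.
have ex' : omega s * x' = x' by rewrite /x' !mulgA ey'.
have x'y : x' * y = omega s.
  by rewrite -ex' -zy -(mulgA z) yx' -mulgA fy.
exists y, x'; split=> //.
- by rewrite yx' fy.
- by rewrite x'y ex'.
- by rewrite /omega1 (mulgA y) -ty -!mulgA ex' yx'.
Qed.

Section SemigroupToLinear.
Local Open Scope ring_scope.
Local Open Scope complex_scope.
Variable R : realType.

Lemma rank_principal_ideal n (rho : S -> 'M[R[i]]_n) s t :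
  {morph rho : x y / (x * y)%g >-> x *m y} ->
  Some t \in principal_ideal s -> (\rank (rho t) <= \rank (rho s))%N.
Proof.
move=> rhoM /principal_idealP[u [v]].
have rank_l x y : (\rank (rho (x * y)%g) <= \rank (rho y))%N.
  by rewrite rhoM mxrankM_maxr.
have rank_r x y : (\rank (rho (x * y)%g) <= \rank (rho x))%N.
  by rewrite rhoM mxrankM_maxl.
case: u v => [u|] [v|] [->].
- exact: leq_trans (rank_r _ _) (rank_l _ _).
- exact: rank_l.
- exact: rank_r.
- exact: leqnn.
Qed.

(** A generalized conjugacy intertwines s and t themselves, not only their
    (omega+1)-st powers, because x' is absorbed by both idempotents. *)
Lemma generalized_conjugates_linear s t :
  (forall k, (1 <= k)%N -> J_equivalent (sgexp s k) (sgexp t k)) ->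
  generalized_conjugates s t -> linear_conjugates R s t.
Proof.
move=> Jst [x [x' [xx'x x'xx' x'x xx' conj]]] n rho rhoM.
have [l l_gt0 [es _]] := omega_exponent2 s t.
have sx' : (s * x')%g = (x' * t)%g.
  have x'f : (x' * omega t)%g = x' by rewrite -xx' mulgA x'xx'.
  have ex' : (omega s * x')%g = x' by rewrite -x'x x'xx'.
  have /eqP ee := omega_idempotent s.
  rewrite -[x' in RHS]x'f -mulgA -mul_omegaC -/(omega1 t) -conj !mulgA x'x.
  by rewrite -mul_omegaC -(mulgA s) ee -mulgA ex'.
have [||k|Q unitQ sQ] :=
  @shift_equivalent_similar _ n l (rho s) (rho t) (rho x') (rho x).
- by rewrite -!rhoM sx'.
- by rewrite -rhoM x'x es; case: l l_gt0 {es} => // l _; apply: morph_sgexp.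
- case: k => [|k]; first by rewrite !expr0.
  have /J_equivalentP[st ts] := Jst k.+1 isT.
  rewrite -!morph_sgexp //; apply/eqP.
  by rewrite eqn_leq !rank_principal_ideal.
exists (invmx Q); first by rewrite unitmx_inv.
by rewrite invmxK -mulmxA sQ mulmxA mulVmx // mul1mx.
Qed.

End SemigroupToLinear.

End GeneralizedConjugacy.

Theorem theorem1 (R : realType) (S : finSemigroupType) (s t : S) :
  (linear_conjugates R s t <->
     (forall k : nat, (1 <= k)%N -> J_equivalent (sgexp s k) (sgexp t k)) /\
     generalized_conjugates s t) /\
  ((forall k : nat, (1 <= k)%N -> J_equivalent (sgexp s k) (sgexp t k)) <->
   (forall k : nat, (1 <= k <= #|S|)%N ->
      J_equivalent (sgexp s k) (sgexp t k))).
Proof.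
split; last exact: J_equivalent_bounded.
split=> [st|[Jst gst]]; last exact: generalized_conjugates_linear.
split=> [k k1|].
  have stk := linear_conjugates_sgexp k1 st.
  apply/J_equivalentP; split; apply: (@linear_conjugates_mem_ideal R) => //.
  exact: linear_conjugates_sym.
have [y [z [ty zy ye]]] := linear_conjugates_intertwiner st.
have [y' [z' [sy' zy' y'f]]] :=
  linear_conjugates_intertwiner (linear_conjugates_sym st).
exact: intertwiners_generalized_conjugates ty zy ye sy' zy' y'f.
Qed.
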